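(* Let $\Omega=\Omega(A)$ be a differential graded algebra of classical type, $\delta$ a degree $-1$ linear map on it of classical type with metric inner product $(\ ,\ )$ and covariant derivative $\nabla$, and let $\tau\in\Omega^1$. (1) $\tau$ conformal Killing for some function $\alpha\in A$ implies $\tau$ metric-conformal, and if $(\ ,\ )$ is nondegenerate then these two notions are equivalent. (2) $\tau$ conformal Killing implies $\mathcal L_\tau\tau=\alpha\tau$, and if $(\ ,\ )$ is invertible with inverse $g=g^1\otimes g^2$ then $\alpha=\delta_\nabla\tau/\beta$ where $\beta=\frac12(g^1,g^2)$ and $\delta_\nabla=\mathfrak i_{g^1}\nabla_{g^2}$. (3) $\tau$ conformal Killing with $\alpha=\delta\tau/\beta$ for some constant $\beta$ and $\delta^2=0$ implies $\tau$ is $\delta$-conformal. (4) $\tau$ $\delta$-conformal for some function $\alpha\in A$ and some constant $\beta$ implies $\tau$ is metric-conformal with factor $\alpha$, and in the nondegenerate case, $(\tau,\mathrm d(\alpha-\delta\tau/\beta))=0$.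
   Context: $k$ is a field of characteristic $\neq 2$ and $A$ a unital $k$-algebra; ''constant'' means element of $k$. A DGA on $A$ is an associative graded algebra $\Omega=\oplus_{n\ge0}\Omega^n$ with $\Omega^0=A$ and a graded derivation $\mathrm d$ of degree 1, $\mathrm d^2=0$. It is standard if $\Omega^1$ is spanned by elements $a\,\mathrm db$ and $\Omega$ is generated by degrees $0,1$; of classical type if it is standard, graded-commutative, and equal to the tensor algebra of $\Omega^1$ over $A$ modulo the relations of antisymmetry. A degree $-1$ linear map $\delta$ on $\Omega$ is of classical type if: there is an $A$-bilinear map $\mathfrak i:\Omega^1\otimes_A\Omega^n\to\Omega^{n-1}$ with $\delta(a\omega)=a\delta\omega+\mathfrak i_{\mathrm da}\omega$; $\delta^2$ is $A$-linear; each $\mathfrak i_{\mathrm da}$ is a graded derivation of degree $-1$; and $\mathfrak i_{\mathrm da}(\mathrm db)=\mathfrak i_{\mathrm db}(\mathrm da)$ for all $a,b\in A$. The metric inner product is $(\omega,\eta)=\mathfrak i_\omega\eta$, $\omega,\eta\in\Omega^1$. It is nondegenerate if $(\omega,\eta)=0$ for all $\omega\in\Omega^1$ implies $\eta=0$, and invertible with inverse $g=g^1\otimes g^2\in\Omega^1\otimes_A\Omega^1$ (sum understood) if $(\omega,g^1)g^2=\omega=g^1(g^2,\omega)$ for all $\omega\in\Omega^1$. $\mathcal L_\omega=\mathrm d\mathfrak i_\omega+\mathfrak i_\omega\mathrm d$ for $\omega\in\Omega^1$. The covariant derivative is $\nabla_\omega\eta=\frac12(L_\delta(\omega,\eta)+\mathcal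 L_\omega\eta+(\mathrm d\omega)\perp\eta)$, $\omega\in\Omega^1$, $\eta\in\Omega$, where $L_\delta(\omega,\eta)=\delta(\omega\eta)-(\delta\omega)\eta-(-1)^{|\omega|}\omega\delta\eta$ and $(\omega_1\omega_2)\perp\eta=\omega_2\mathfrak i_{\omega_1}\eta-\omega_1\mathfrak i_{\omega_2}\eta$ for $\omega_i\in\Omega^1$ (so $(\mathrm d\omega)\perp\eta=\mathfrak i_\eta\mathrm d\omega$ when $\eta\in\Omega^1$). $\tau\in\Omega^1$ is, for $\alpha\in A$: - metric-conformal (with factor $\alpha$) if $(\mathcal L_\tau\omega,\eta)+(\omega,\mathcal L_\tau\eta)=(\tau,\mathrm d(\omega,\eta))+\alpha(\omega,\eta)$ for all $\omega,\eta\in\Omega^1$; - conformal Killing if $\nabla_\omega\tau=\frac12\mathfrak i_\omega\mathrm d\tau+\frac\alpha2\omega$ for all $\omega\in\Omega^1$; - $\delta$-conformal (with $\alpha\in A$ and constant $\beta\in k$) if $[\delta,\mathcal L_\tau]\omega=\alpha\delta\omega+(1-\beta)\mathfrak i_{\mathrm d\alpha}\omega$ for all $\omega\in\Omega^1$. *)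

(* Defs.v *)
From HB Require Import structures.
From mathcomp Require Import all_boot all_order all_algebra.
From mathcomp Require Import boolp classical_sets.

Set Implicit Arguments.
Unset Strict Implicit.
Unset Printing Implicit Defensive.

Import GRing.Theory.
Local Open Scope classical_set_scope.
Local Open Scope ring_scope.

(* The grading is internal: [gr Om n] is the k-subspace Om^n of the k-algebra
   Om, and Om^0 is identified with A through [inA]. *)
Record dga (k : fieldType) (A : algType k) := DGA {
  dga_alg :> algType k;
  gr : nat -> set dga_alg;
  inA : {lrmorphism A -> dga_alg};
  dd : {linear dga_alg -> dga_alg};
  gr_zero : forall n, gr n 0;
  gr_lin : forall n (c : k) x y, gr n x -> gr n y -> gr n (c *: x + y);
  gr_mul : forall m n x y, gr m x -> gr n y -> gr (m + n)%N (x * y);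
  gr_span : forall x, exists N (y : nat -> dga_alg),
    (forall n, gr n (y n)) /\ x = \sum_(n < N) y n;
  gr_free : forall N (y : nat -> dga_alg), (forall n, gr n (y n)) ->
    \sum_(n < N) y n = 0 -> forall n, (n < N)%N -> y n = 0;
  gr0P : forall x, gr 0%N x <-> exists a, x = inA a;
  inA_inj : injective inA;
  dd_gr : forall n x, gr n x -> gr n.+1 (dd x);
  dd_leibniz : forall n x y, gr n x ->
    dd (x * y) = dd x * y + (-1) ^+ n *: (x * dd y);
  dd_dd : forall x, dd (dd x) = 0
}.

Arguments gr {k A}.
Arguments inA {k A}.
Arguments dd {k A}.

Section ClassicalType.
Variables (k : fieldType) (A : algType k) (Om : dga A).

Inductive generated01 : set Om :=
| Gen0 x : gr Om 0 x -> generated01 x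
| Gen1 x : gr Om 1 x -> generated01 x
| GenD x y : generated01 x -> generated01 y -> generated01 (x + y)
| GenM x y : generated01 x -> generated01 y -> generated01 (x * y).

Definition standard : Prop :=
  (forall w, gr Om 1 w ->
     exists s : seq (A * A), w = \sum_(p <- s) inA Om p.1 * dd Om (inA Om p.2))
  /\ forall x, generated01 x.

Definition graded_commutative : Prop :=
  forall m n (x y : Om), gr Om m x -> gr Om n y ->
    x * y = (-1) ^+ (m * n) *: (y * x).

(* Formal expressions in elements of A and of Om^1.  Modulo [teq] they form the
   quotient of the tensor algebra of the A-bimodule Om^1 by antisymmetry:
   [teq] is the congruence generated by the unital ring axioms, by the ring
   structure of A, by the A-bimodule structure of Om^1 and by antisymmetry.
   Opposites need no constructor: - e is [TMul (TA (-1)) e]. *)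
Inductive texp : Type :=
| TA of A
| TM x of gr Om 1 x
| TAdd of texp & texp
| TMul of texp & texp.

Inductive teq : texp -> texp -> Prop :=
| teq_refl e : teq e e
| teq_sym e f : teq e f -> teq f e
| teq_trans e f g : teq e f -> teq f g -> teq e g
| teq_add e e' f f' : teq e e' -> teq f f' -> teq (TAdd e f) (TAdd e' f')
| teq_mul e e' f f' : teq e e' -> teq f f' -> teq (TMul e f) (TMul e' f')
| teq_addA e f g : teq (TAdd e (TAdd f g)) (TAdd (TAdd e f) g)
| teq_addC e f : teq (TAdd e f) (TAdd f e)
| teq_add0 e : teq (TAdd (TA 0) e) e
| teq_mulA e f g : teq (TMul e (TMul f g)) (TMul (TMul e f) g)
| teq_mul1l e : teq (TMul (TA 1) e) e
| teq_mul1r e : teq (TMul e (TA 1)) e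
| teq_mul0 e : teq (TMul (TA 0) e) (TA 0)
| teq_mulDl e f g : teq (TMul (TAdd e f) g) (TAdd (TMul e g) (TMul f g))
| teq_mulDr e f g : teq (TMul e (TAdd f g)) (TAdd (TMul e f) (TMul e g))
| teq_AD a b : teq (TA (a + b)) (TAdd (TA a) (TA b))
| teq_AM a b : teq (TA (a * b)) (TMul (TA a) (TA b))
| teq_MD x y (hx : gr Om 1 x) (hy : gr Om 1 y) (h : gr Om 1 (x + y)) :
    teq (TM h) (TAdd (TM hx) (TM hy))
| teq_MAl a x (hx : gr Om 1 x) (h : gr Om 1 (inA Om a * x)) :
    teq (TM h) (TMul (TA a) (TM hx))
| teq_MAr a x (hx : gr Om 1 x) (h : gr Om 1 (x * inA Om a)) :
    teq (TM h) (TMul (TM hx) (TA a))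
| teq_antisym x y (hx : gr Om 1 x) (hy : gr Om 1 y) :
    teq (TMul (TM hx) (TM hy)) (TMul (TA (-1)) (TMul (TM hy) (TM hx))).

Fixpoint teval (e : texp) : Om :=
  match e with
  | TA a => inA Om a
  | @TM x _ => x
  | TAdd e f => teval e + teval f
  | TMul e f => teval e * teval f
  end.

(* [standard] makes [teval] surjective and [graded_commutative] makes it
   compatible with [teq]; the last clause is injectivity modulo [teq]. *)
Definition classical_type : Prop :=
  [/\ standard, graded_commutative &
      forall e f : texp, teval e = teval f -> teq e f].

End ClassicalType.

Section Codifferential.
Variables (k : fieldType) (A : algType k) (Om : dga A).
Implicit Types (delta : Om -> Om) (i : Om -> Om -> Om).
Implicit Types (w x y eta tau : Om) (a b alpha : A) (g : seq (Om * Om)).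
Local Notation d := (dd Om).
Local Notation "a %:O" := (inA Om a) (at level 1, format "a %:O").

Definition degree_minus_one (f : Om -> Om) : Prop :=
  (forall x, gr Om 0 x -> f x = 0) /\
  (forall n x, gr Om n.+1 x -> gr Om n (f x)).

(* The interior product [i w x] is only meaningful for w in Om^1.  As A is
   central in Om for Om of classical type, an A-bilinear map out of the tensor
   product over A is a map that is A-linear in each argument. *)
Definition interior_product i : Prop :=
  [/\ forall w, gr Om 1 w -> degree_minus_one (i w),
      forall a w w' x, gr Om 1 w -> gr Om 1 w' ->
        i (a%:O * w + w') x = a%:O * i w x + i w' x &
      forall a w x y, gr Om 1 w -> i w (a%:O * x + y) = a%:O * i w x + i w y].

Definition classical_codiff delta i : Prop :=
  [/\ degree_minus_one delta,
      interior_product i,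
      forall a x, delta (a%:O * x) = a%:O * delta x + i (d a%:O) x,
      forall a x, delta (delta (a%:O * x)) = a%:O * delta (delta x) &
      (forall a n x y, gr Om n x ->
        i (d a%:O) (x * y) = i (d a%:O) x * y + (-1) ^+ n *: (x * i (d a%:O) y))
      /\ (forall a b, i (d a%:O) (d b%:O) = i (d b%:O) (d a%:O))].

Definition inner i w eta : Om := i w eta.

Definition metric_nondegenerate i : Prop :=
  forall eta, gr Om 1 eta ->
    (forall w, gr Om 1 w -> inner i w eta = 0) -> eta = 0.

(* A finite sequence g of pairs represents the sum of the tensors p.1 (x) p.2,
   for p in g. *)
Definition inverse_metric i g : Prop :=
  (forall p, p \in g -> gr Om 1 p.1 /\ gr Om 1 p.2) /\
  (forall w, gr Om 1 w ->
     \sum_(p <- g) inner i w p.1 * p.2 = w /\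
     \sum_(p <- g) p.1 * inner i p.2 w = w).

Definition lie i w x : Om := d (i w x) + i w (d x).

(* L_delta(w, eta) for w of degree n. *)
Definition Ldelta delta (n : nat) w eta : Om :=
  delta (w * eta) - delta w * eta - (-1) ^+ n *: (w * delta eta).

Definition decomposes2 (chi : Om) (s : seq (Om * Om)) : Prop :=
  (forall p, p \in s -> gr Om 1 p.1 /\ gr Om 1 p.2) /\
  chi = \sum_(p <- s) p.1 * p.2.

(* [perp] is defined through a chosen decomposition of chi in Om^2 as a sum of
   products of 1-forms; [perpE] below shows that the choice is immaterial. *)
Definition perp i (chi eta : Om) : Om :=
  \sum_(p <- xget [::] [set s | decomposes2 chi s])
    (p.2 * i p.1 eta - p.1 * i p.2 eta).

Definition nabla delta i w eta : Om :=
  2%:R^-1 *: (Ldelta delta 1 w eta + lie i w eta + perp i (d w) eta).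

Definition delta_nabla delta i g eta : Om :=
  \sum_(p <- g) i p.1 (nabla delta i p.2 eta).

Definition metric_conformal i tau alpha : Prop :=
  forall w eta, gr Om 1 w -> gr Om 1 eta ->
    inner i (lie i tau w) eta + inner i w (lie i tau eta)
    = inner i tau (d (inner i w eta)) + alpha%:O * inner i w eta.

Definition conformal_killing delta i tau alpha : Prop :=
  forall w, gr Om 1 w ->
    nabla delta i w tau
    = 2%:R^-1 *: i w (d tau) + 2%:R^-1 *: (alpha%:O * w).

Definition delta_conformal delta i tau alpha (beta : k) : Prop :=
  forall w, gr Om 1 w ->
    delta (lie i tau w) - lie i tau (delta w)
    = alpha%:O * delta w + (1 - beta) *: i (d alpha%:O) w.

End Codifferential.

Section PerpWellDefined.
Variables (k : fieldType) (A : algType k) (Om : dga A) (i : Om -> Om -> Om).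
Hypotheses (Om_classical : classical_type Om) (int_i : interior_product i).
Variable eta : Om.

Let gc : graded_commutative Om.
Proof. by case: Om_classical. Qed.

Let grD n (x y : Om) : gr Om n x -> gr Om n y -> gr Om n (x + y).
Proof. by move=> hx hy; rewrite -[x]scale1r; apply: gr_lin. Qed.

Let cen (a x : Om) n : gr Om 0 a -> gr Om n x -> a * x = x * a.
Proof. by move=> ha hx; rewrite (gc ha hx) mul0n expr0 scale1r. Qed.

Let phi (w v : Om) : Om := v * i w eta - w * i v eta.

Let phiDl (a w w' v : Om) : gr Om 0 a -> gr Om 1 w -> gr Om 1 w' ->
  gr Om 1 v -> phi (a * w + w') v = a * phi w v + phi w' v.
Proof.
case: int_i => _ il _ /gr0P [a' ->] hw hw' hv.
rewrite /phi il // mulrDl mulrDr mulrBr opprD !mulrA addrACA.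
by congr (_ - _ + _); rewrite -(@cen (inA Om a') v 1) //; apply/gr0P; exists a'.
Qed.

Let phiN (w v : Om) : phi w v = - phi v w.
Proof. by rewrite /phi opprB. Qed.

Let phiDr (a w w' v : Om) : gr Om 0 a -> gr Om 1 w -> gr Om 1 w' ->
  gr Om 1 v -> phi v (a * w + w') = a * phi v w + phi v w'.
Proof. by move=> *; rewrite phiN phiDl // opprD -mulrN -!phiN. Qed.

(* The truncated tensor algebra A (+) Om^1 (+) Om in which two 1-forms w, v
   multiply to phi w v; [F] is the evaluation of expressions in it. *)
Let B : Type := (Om * Om * Om)%type.
Let addB (p q : B) : B := (p.1.1 + q.1.1, p.1.2 + q.1.2, p.2 + q.2).
Let mulB (p q : B) : B :=
  (p.1.1 * q.1.1, p.1.1 * q.1.2 + q.1.1 * p.1.2,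
   p.1.1 * q.2 + q.1.1 * p.2 + phi p.1.2 q.1.2).
Let F := fix F (e : texp Om) : B :=
  match e with
  | TA a => (inA Om a, 0, 0)
  | @TM _ _ _ x _ => (0, x, 0)
  | TAdd e f => addB (F e) (F f)
  | TMul e f => mulB (F e) (F f)
  end.

Let gr0A a : gr Om 0 (inA Om a).
Proof. by apply/gr0P; exists a. Qed.

Let F0 e : gr Om 0 (F e).1.1.
Proof.
elim: e => [a|x hx|e he f hf|e he f hf] /=.
- exact: gr0A.
- exact: gr_zero.
- exact: grD.
- exact: (gr_mul he hf).
Qed.

Let F1 e : gr Om 1 (F e).1.2.
Proof.
elim: e => [a|x hx|e he f hf|e he f hf] //=.
- exact: gr_zero.
- exact: grD.
- by apply: grD; [apply: (gr_mul (F0 e))|apply: (gr_mul (F0 f))].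
Qed.

Let cen0 (a b : Om) : gr Om 0 a -> gr Om 0 b -> a * b = b * a.
Proof. by move=> *; apply: (@cen a b 0). Qed.

Let gr01 : gr Om 0 1.
Proof. by apply/gr0P; exists 1; rewrite rmorph1. Qed.

Let phi0l v : gr Om 1 v -> phi 0 v = 0.
Proof.
move=> hv; have := @phiDl 1 0 0 v gr01 (gr_zero _ _) (gr_zero _ _) hv.
by rewrite mulr0 addr0 mul1r => /eqP; rewrite -subr_eq0 opprD addNKr oppr_eq0
  => /eqP.
Qed.

Let phi0r v : gr Om 1 v -> phi v 0 = 0.
Proof. by move=> hv; rewrite phiN phi0l ?oppr0. Qed.

Let phiMl a w v : gr Om 0 a -> gr Om 1 w -> gr Om 1 v ->
  phi (a * w) v = a * phi w v.
Proof.
move=> ha hw hv; rewrite -[a * w]addr0 phiDl ?phi0l ?addr0 //.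
exact: gr_zero.
Qed.

Let phiMr a w v : gr Om 0 a -> gr Om 1 w -> gr Om 1 v ->
  phi v (a * w) = a * phi v w.
Proof. by move=> *; rewrite phiN phiMl // -mulrN -phiN. Qed.

Let phiAl w w' v : gr Om 1 w -> gr Om 1 w' -> gr Om 1 v ->
  phi (w + w') v = phi w v + phi w' v.
Proof.
move=> hw hw' hv; rewrite -{1}[w]mul1r phiDl ?mul1r //; exact: gr01.
Qed.

Let phiAr w w' v : gr Om 1 w -> gr Om 1 w' -> gr Om 1 v ->
  phi v (w + w') = phi v w + phi v w'.
Proof. by move=> *; rewrite phiN phiAl // opprD -!phiN. Qed.

Let F_teq e f : teq e f -> F e = F f.
Proof.
elim=> {e f} //=.
- by move=> e f g _ -> _ ->.
- by move=> e e' f f' _ -> _ ->.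
- by move=> e e' f f' _ -> _ ->.
- by move=> e f g; rewrite /addB /= !addrA.
- by move=> e f; congr (_, _, _); rewrite addrC.
- by move=> e; rewrite /addB /= rmorph0 !add0r; case: (F e) => [[]].
- move=> e f g; move: (F0 e) (F1 e) (F0 f) (F1 f) (F0 g) (F1 g).
  move: (F e) (F f) (F g).
  move=> [[a w] x] [[b v] y] [[c u] z] /= a0 w1 b0 v1 c0 u1.
  have mul01 p q : gr Om 0 p -> gr Om 1 q -> gr Om 1 (p * q).
    by move=> hp hq; apply: (gr_mul hp hq).
  rewrite /mulB /=; congr (_, _, _).
  + by rewrite mulrA.
  + by rewrite !mulrDr !mulrA addrA (cen0 a0 c0) (cen0 b0 c0).
  + rewrite phiAl ?phiAr ?phiMl ?phiMr //; try exact: mul01.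
    move: (phi v u) (phi w u) (phi w v) => p q r.
    rewrite !mulrDr !mulrA (cen0 a0 c0) (cen0 b0 c0) -!addrA.
    do 2!congr (_ + _); rewrite addrCA; congr (_ + _).
    by rewrite addrA addrC.
- move=> e; rewrite /mulB /= rmorph1 phi0l //.
  by rewrite !mul1r !mulr0 !addr0; case: (F e) => [[]].
- move=> e; rewrite /mulB /= rmorph1 phi0r //.
  by rewrite !mul1r !mulr1 !mulr0 !add0r addr0; case: (F e) => [[]].
- move=> e; rewrite /mulB /= rmorph0 phi0l //.
  by rewrite !mul0r !mulr0 !addr0.
- move=> e f g; rewrite /mulB /addB /= phiAl // !mulrDl !mulrDr.
  by rewrite [X in (_, X, _)]addrACA [X in (_, _, X + _)]addrACA
    [X in (_, _, X)]addrACA.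
- move=> e f g; rewrite /mulB /addB /= phiAr // !mulrDl !mulrDr.
  by rewrite [X in (_, X, _)]addrACA [X in (_, _, X + _)]addrACA
    [X in (_, _, X)]addrACA.
- by move=> a b; rewrite /addB /= rmorphD !addr0.
- move=> a b; rewrite /mulB /= rmorphM (phi0l (gr_zero Om 1)).
  by rewrite !mulr0 !addr0.
- by move=> x y hx hy h; rewrite /addB /= !addr0.
- by move=> a x hx h; rewrite /mulB /= phi0l // !mulr0 !addr0.
- move=> a x hx h; rewrite /mulB /= phi0r // !mul0r !mulr0 !addr0 !add0r.
  by rewrite (cen (gr0A a) hx).
- move=> x y hx hy; rewrite /mulB /= !mul0r !mulr0 !addr0 !add0r.
  rewrite (phi0l (gr_zero Om 1)) !addr0 rmorphN1 !mulN1r oppr0.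
  by congr (_, _, _); apply: phiN.
Qed.

Let expr_of s : (forall p, p \in s -> gr Om 1 p.1 /\ gr Om 1 p.2) ->
  exists e : texp Om, teval e = \sum_(p <- s) p.1 * p.2 /\
    F e = (0, 0, \sum_(p <- s) phi p.1 p.2).
Proof.
elim: s => [|p s IH] hs.
  by exists (TA Om 0); rewrite !big_nil /= rmorph0.
have [h1 h2] := hs p (mem_head _ _).
case: IH => [q qs|e [e1 e2]]; first by apply: hs; rewrite inE qs orbT.
exists (TAdd (TMul (TM h1) (TM h2)) e); rewrite !big_cons /= e1 e2; split=> //.
by rewrite /mulB /addB /= !mul0r !add0r.
Qed.

Lemma perpE chi s : decomposes2 chi s ->
  perp i chi eta = \sum_(p <- s) (p.2 * i p.1 eta - p.1 * i p.2 eta).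
Proof.
move=> hs; have [ht1 ht2] : decomposes2 chi (xget [::] [set s | decomposes2 chi s]).
  exact: (@xgetI _ _ [set s | decomposes2 chi s] s hs).
case: hs => hs1 hs2; rewrite /perp.
have [e [e1 e2]] := expr_of ht1; have [f [f1 f2]] := expr_of hs1.
case: Om_classical => _ _ inj.
have /F_teq : teq e f by apply: inj; rewrite e1 f1 -ht2.
by rewrite e2 f2 => -[].
Qed.

End PerpWellDefined.

(* Main.v *)
(* Write (w, e) for the metric. A-linearity of delta^2 says that delta
   anticommutes with the interior products by exact forms. This gives a formula
   for (e, L_delta(w, tau)) in terms of d and i alone ([int_Ldelta]), while
   "tau is conformal Killing" unfolds to L_delta(w, tau) + L_tau w = alpha w
   for all 1-forms w ([conformal_killingP]). Pairing the latter with e gives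
   exactly the metric-conformal condition, setting w = tau gives
   L_tau tau = alpha tau, and applying delta to it gives [delta_lie_killing],
   from which (3) and the last claim of (4) follow. For the first claim of (4),
   compare the delta-conformal condition on b e with b times that on e. *)
Require Import Defs.
From HB Require Import structures.
From mathcomp Require Import all_boot all_order all_algebra.
From mathcomp Require Import boolp classical_sets.

Import GRing.Theory.
Local Open Scope ring_scope.

Section ClassicalTypeTheory.
Set Implicit Arguments.
Unset Strict Implicit.
Unset Printing Implicit Defensive.

Variables (k : fieldType) (A : algType k) (Om : dga A).
Hypothesis Om_classical : classical_type Om.
Local Notation d := (dd Om).
Local Notation "a %:O" := (inA Om a) (at level 1, format "a %:O").
Implicit Types (a b : A) (x y w t e : Om).

(** * Degrees, centrality of A, and induction on one-forms *)

Lemma gr_inA a : gr Om 0 a%:O.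
Proof. by apply/gr0P; exists a. Qed.

Lemma gr_add n x y : gr Om n x -> gr Om n y -> gr Om n (x + y).
Proof. by move=> hx hy; rewrite -[x]scale1r; apply: gr_lin. Qed.

Lemma gr_scale n (c : k) x : gr Om n x -> gr Om n (c *: x).
Proof. by move=> hx; rewrite -[_ *: _]addr0; apply: gr_lin => //; apply: gr_zero. Qed.

Lemma gr_opp n x : gr Om n x -> gr Om n (- x).
Proof. by move=> hx; rewrite -scaleN1r; apply: gr_scale. Qed.

Lemma gr_inAM n a x : gr Om n x -> gr Om n (a%:O * x).
Proof. exact/(gr_mul (gr_inA a)). Qed.

Lemma gr_sum n (I : Type) (r : seq I) (F : I -> Om) :
  (forall j, gr Om n (F j)) -> gr Om n (\sum_(j <- r) F j).
Proof.
move=> hF; elim/big_rec: _ => [|j x _ hx]; [exact: gr_zero | exact: gr_add].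
Qed.

Lemma gr_d_inA a : gr Om 1 (d a%:O).
Proof. exact/dd_gr/gr_inA. Qed.

Lemma inA_central a x : x * a%:O = a%:O * x.
Proof.
have [_ gc _] := Om_classical.
have [N [y [hy ->]]] := gr_span x.
rewrite mulr_suml mulr_sumr; apply: eq_bigr => n _.
by rewrite (gc _ _ _ _ (hy n) (gr_inA a)) muln0 expr0 scale1r.
Qed.

Lemma gr0_central f x : gr Om 0 f -> x * f = f * x.
Proof. by case/gr0P => a ->; apply: inA_central. Qed.

Lemma mul1form_anti w t : gr Om 1 w -> gr Om 1 t -> w * t = - (t * w).
Proof.
have [_ gc _] := Om_classical.
by move=> hw ht; rewrite (gc _ _ _ _ hw ht) muln1 expr1 scaleN1r.
Qed.

(** Standardness makes every one-form a finite sum of terms [a * d b], so an identity that is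
    A-linear in [w] need only be checked on exact forms. *)
Lemma one_form_ind (P : Om -> Prop) : P 0 ->
  (forall a b w, gr Om 1 w -> P w -> P (a%:O * d b%:O + w)) ->
  forall w, gr Om 1 w -> P w.
Proof.
have [[span _] _ _] := Om_classical.
move=> P0 PS w /span [s ->]; elim: s => [|p s IH]; first by rewrite big_nil.
rewrite big_cons; apply: PS => //; apply: gr_sum => q.
exact/gr_inAM/gr_d_inA.
Qed.

Lemma dd_inAM a x : d (a%:O * x) = d a%:O * x + a%:O * d x.
Proof. by rewrite (dd_leibniz _ (gr_inA a)) expr0 scale1r. Qed.

Lemma dd_adb a b : d (a%:O * d b%:O) = d a%:O * d b%:O.
Proof. by rewrite dd_inAM dd_dd mulr0 addr0. Qed.

(** Guarantees that the choice made in [perp] is a genuine decomposition rather than the default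
    empty list. It rests on d(a db) = da db. *)
Lemma dd_one_form_decomposes w : gr Om 1 w -> exists s, decomposes2 (d w) s.
Proof.
move: w; apply: one_form_ind => [|a b w _ [s [hs e]]].
  by exists [::]; split=> //; rewrite linear0 big_nil.
exists ((d a%:O, d b%:O) :: s); split.
  move=> p; rewrite inE => /orP [/eqP ->|/hs //].
  by split; apply: gr_d_inA.
by rewrite linearD dd_adb big_cons e.
Qed.

(** * The interior product: linearity, symmetry and the derivation rule *)

Section InteriorProduct.
Variables (delta : {linear Om -> Om}) (i : Om -> Om -> Om).
Hypothesis delta_classical : classical_codiff delta i.

Let int_i : interior_product i.
Proof. by case: delta_classical. Qed.

Lemma int_deg0 w x : gr Om 1 w -> gr Om 0 x -> i w x = 0.
Proof. by case: int_i => h _ _ /h [h0 _]; apply: h0. Qed.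

Lemma gr_int n w x : gr Om 1 w -> gr Om n.+1 x -> gr Om n (i w x).
Proof. by case: int_i => h _ _ /h [_ hS]; apply: hS. Qed.

Lemma intDZl a w w' x : gr Om 1 w -> gr Om 1 w' ->
  i (a%:O * w + w') x = a%:O * i w x + i w' x.
Proof. by case: int_i => _ h _; apply: h. Qed.

Lemma intDZr a w x y : gr Om 1 w -> i w (a%:O * x + y) = a%:O * i w x + i w y.
Proof. by case: int_i => _ _ h; apply: h. Qed.

Lemma intDl w w' x : gr Om 1 w -> gr Om 1 w' -> i (w + w') x = i w x + i w' x.
Proof.
by move=> hw hw'; rewrite -{1}[w]mul1r -(rmorph1 (inA Om)) intDZl // rmorph1 mul1r.
Qed.

Lemma intDr w x y : gr Om 1 w -> i w (x + y) = i w x + i w y.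
Proof. by move=> hw; rewrite -{1}[x]mul1r -(rmorph1 (inA Om)) intDZr // rmorph1 mul1r. Qed.

Lemma int0l x : i 0 x = 0.
Proof.
have := intDl x (gr_zero Om 1%N) (gr_zero Om 1%N).
by rewrite addr0 => /eqP; rewrite -subr_eq0 opprD addNKr oppr_eq0 => /eqP.
Qed.

Lemma int0r w : gr Om 1 w -> i w 0 = 0.
Proof.
move=> hw; have := intDr 0 0 hw.
by rewrite addr0 => /eqP; rewrite -subr_eq0 opprD addNKr oppr_eq0 => /eqP.
Qed.

Lemma intMl a w x : gr Om 1 w -> i (a%:O * w) x = a%:O * i w x.
Proof.
by move=> hw; rewrite -[_ * w]addr0 intDZl ?int0l ?addr0 //; apply: gr_zero.
Qed.

Lemma intMr a w x : gr Om 1 w -> i w (a%:O * x) = a%:O * i w x.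
Proof. by move=> hw; rewrite -[_ * x]addr0 intDZr // int0r // addr0. Qed.

Lemma intMr0 f w x : gr Om 1 w -> gr Om 0 f -> i w (f * x) = f * i w x.
Proof. by move=> hw /gr0P [a ->]; apply: intMr. Qed.

Lemma intMl0 f w x : gr Om 1 w -> gr Om 0 f -> i (f * w) x = f * i w x.
Proof. by move=> hw /gr0P [a ->]; apply: intMl. Qed.

Lemma intMr0r f w x : gr Om 1 w -> gr Om 0 f -> i w (x * f) = i w x * f.
Proof. by move=> hw hf; rewrite !(gr0_central _ hf) intMr0. Qed.

Lemma intZr (c : k) w x : gr Om 1 w -> i w (c *: x) = c *: i w x.
Proof.
move=> hw; rewrite -[x in LHS]mul1r scalerAl.
by rewrite -(rmorph1 (inA Om)) -linearZ intMr // linearZ rmorph1 -scalerAl mul1r.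
Qed.

Lemma intNr w x : gr Om 1 w -> i w (- x) = - i w x.
Proof. by move=> hw; rewrite -!scaleN1r intZr. Qed.

Lemma intBr w x y : gr Om 1 w -> i w (x - y) = i w x - i w y.
Proof. by move=> hw; rewrite intDr // intNr. Qed.

(** One induction per argument reduces the claim, by A-linearity, to two exact forms, where it is an
    axiom. *)
Lemma int_sym w t : gr Om 1 w -> gr Om 1 t -> i w t = i t w.
Proof.
case: delta_classical => _ _ _ _ [_ sym].
move=> hw; move: w hw t; apply: one_form_ind => [t ht|a b w hw IH t ht].
  by rewrite int0l int0r.
have hb := gr_d_inA b.
rewrite intDZl // intDZr // IH //; congr (_ * _ + _).
move: t ht; apply: one_form_ind => [|a' b' w' hw' IH'].
  by rewrite int0l int0r.
have hb' := gr_d_inA b'.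
by rewrite (intDZr _ _ _ hb) (intDZl _ _ hb' hw') IH' (sym b b').
Qed.

(** The rule is assumed for exact [w]; both sides are A-linear in [w] because A is central. *)
Lemma int_derivation n w x y : gr Om 1 w -> gr Om n x ->
  i w (x * y) = i w x * y + (-1) ^+ n *: (x * i w y).
Proof.
case: delta_classical => _ _ _ _ [der _].
move=> hw hx; move: w hw; apply: one_form_ind => [|a b w hw IH].
  by rewrite !int0l mul0r mulr0 scaler0 addr0.
have hb := gr_d_inA b.
rewrite !intDZl // IH (der _ _ _ y hx) !mulrDr !mulrDl scalerDr -scalerAr.
by rewrite !mulrA (inA_central a x) addrACA.
Qed.

Lemma int_mul11 w x y : gr Om 1 w -> gr Om 1 x ->
  i w (x * y) = i w x * y - x * i w y.
Proof. by move=> hw hx; rewrite (int_derivation _ hw hx) expr1 scaleN1r. Qed.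

(** On a product of one-forms, i_t(uv) = (t,u)v - u(t,v), which is the defining formula of [perp]
    once the metric is known to be symmetric. *)
Lemma perp_one_form w t : gr Om 1 w -> gr Om 1 t -> perp i (d w) t = i t (d w).
Proof.
move=> hw ht; have [s hs] := dd_one_form_decomposes hw.
rewrite (perpE Om_classical int_i t hs); case: hs => hs ->.
elim: s hs => [|p s IH] hs; first by rewrite !big_nil int0r.
have [h1 h2] := hs p (mem_head _ _).
rewrite !big_cons intDr // IH => [|q qs]; last by apply: hs; rewrite inE qs orbT.
rewrite int_mul11 // (int_sym ht h1) (int_sym ht h2).
by rewrite (gr0_central p.2 (gr_int h1 ht)).
Qed.

(** * The codifferential and its Leibniz defect [Ldelta] *)

Lemma deltaM a x : delta (a%:O * x) = a%:O * delta x + i (d a%:O) x.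
Proof. by case: delta_classical. Qed.

Lemma deltaM0 f x : gr Om 0 f -> delta (f * x) = f * delta x + i (d f) x.
Proof. by case/gr0P => a ->; apply: deltaM. Qed.

Lemma gr_delta n x : gr Om n.+1 x -> gr Om n (delta x).
Proof. by case: delta_classical => [[_ h]] *; apply: h. Qed.

(* This is the content of the A-linearity of delta^2. *)
Lemma delta_int_d a x : delta (i (d a%:O) x) = - i (d a%:O) (delta x).
Proof.
case: delta_classical => _ _ _ /(_ a x) + _.
rewrite deltaM linearD deltaM -addrA => /eqP.
by rewrite -subr_eq0 addrAC subrr add0r addrC addr_eq0 => /eqP.
Qed.

Lemma int_d_inAM w a f : gr Om 1 w -> gr Om 0 f ->
  i w (d (a%:O * f)) = i w (d a%:O) * f + a%:O * i w (d f).
Proof. by move=> hw hf; rewrite dd_inAM intDr // intMr0r // intMr. Qed.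

(** The left side is A-linear in [e]. On the right, the Leibniz terms that e = a db produces in the
    first two summands cancel against i_w i_t(da db), so exact [e] suffice. *)
Lemma int_Ldelta w t e : gr Om 1 w -> gr Om 1 t -> gr Om 1 e ->
  i e (Ldelta delta 1 w t)
  = i w (d (i e t)) - i t (d (i e w)) + i w (i t (d e)).
Proof.
move=> hw ht; move: e; apply: one_form_ind => [|a b e he IH].
  by rewrite !int0l !linear0 !int0r // subrr addr0.
have ha := gr_d_inA a; have hb := gr_d_inA b.
have hbw : gr Om 0 (i (d b%:O) w) by apply: gr_int.
have hbt : gr Om 0 (i (d b%:O) t) by apply: gr_int.
(* For e = db, the interior product moves inside [delta] at the cost of a sign. There [delta] meets
   functions times one-forms, and all terms in [delta w] and [delta t] cancel. *)
have Lb : i (d b%:O) (Ldelta delta 1 w t)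
    = i w (d (i (d b%:O) t)) - i t (d (i (d b%:O) w)).
  rewrite /Ldelta expr1 scaleN1r opprK intDr // intBr //.
  rewrite (int_mul11 (delta t)) // (int_deg0 hb (gr_delta ht)) mulr0 subr0.
  rewrite (intMr0 _ _ (gr_delta hw)) //.
  have -> : i (d b%:O) (delta (w * t)) = - delta (i (d b%:O) (w * t)).
    by rewrite delta_int_d opprK.
  rewrite int_mul11 // (gr0_central w hbt) linearB !deltaM0 //.
  rewrite (int_sym hw (dd_gr hbt)) (int_sym ht (dd_gr hbw)).
  rewrite (gr0_central _ hbt).
  set p := _ * delta t; set q := _ * delta w.
  rewrite opprB opprD -!addrA addrC -!addrA; congr (_ + _).
  by rewrite addrCA (addrC p) addKr addNr addr0.
rewrite !intDZl // IH Lb !linearD dd_adb !intDr // !int_d_inAM //.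
rewrite (int_sym hb ht) (int_sym hb hw).
have -> : i w (i t (d a%:O * d b%:O))
    = i t (d a%:O) * i w (d b%:O) - i w (d a%:O) * i t (d b%:O).
  rewrite int_mul11 // intBr //.
  by rewrite (intMr0 _ hw (gr_int ht ha)) (intMr0r _ hw (gr_int ht hb)).
rewrite (gr0_central _ (gr_int hw hb)) (gr0_central _ (gr_int ht hb)).
rewrite mulrBr !opprD !addrA.
by rewrite [RHS](ACl ((1*8)*(7*4)*(2*5*3*6*9)))%AC /= !subrr !add0r.
Qed.

(** * Lie and covariant derivatives on one-forms, and the two conformality conditions *)

Lemma gr_lie t w : gr Om 1 t -> gr Om 1 w -> gr Om 1 (lie i t w).
Proof.
by move=> ht hw; apply: gr_add; [apply/dd_gr/gr_int | apply/gr_int/dd_gr].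
Qed.

Lemma gr_Ldelta w t : gr Om 1 w -> gr Om 1 t -> gr Om 1 (Ldelta delta 1 w t).
Proof.
move=> hw ht; have hM (x y : Om) : gr Om 0 x -> gr Om 1 y -> gr Om 1 (x * y).
  by move=> hx hy; apply: (gr_mul hx hy).
rewrite /Ldelta; apply: gr_add; first apply: gr_add.
- by apply: gr_delta; apply: (gr_mul hw ht).
- by apply: gr_opp; apply: hM => //; apply: gr_delta.
- apply: gr_opp; apply: gr_scale; rewrite (gr0_central _ (gr_delta ht)).
  by apply: hM => //; apply: gr_delta.
Qed.

Lemma lie0 t f : gr Om 1 t -> gr Om 0 f -> lie i t f = i t (d f).
Proof. by move=> ht hf; rewrite /lie (int_deg0 ht hf) linear0 add0r. Qed.

Lemma lie_inAM t a x : gr Om 1 t ->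
  lie i t (a%:O * x) = i t (d a%:O) * x + a%:O * lie i t x.
Proof.
move=> ht; have ha := gr_d_inA a.
rewrite /lie intMr // !dd_inAM intDr // int_mul11 // intMr // mulrDr.
by rewrite [LHS](AC (2*(2*1)) ((3*(2*5))*(1*4)))%AC /= subrr addr0.
Qed.

(** By symmetry of the metric, d(w,t) joins i_t(dw) to form L_t w. What is split off, i_w(dt), is
    the term on the right of the conformal Killing equation. *)
Lemma nabla_one_form w t : gr Om 1 w -> gr Om 1 t ->
  nabla delta i w t
  = 2%:R^-1 *: (Ldelta delta 1 w t + lie i t w) + 2%:R^-1 *: i w (d t).
Proof.
move=> hw ht; rewrite /nabla perp_one_form // -scalerDr /lie (int_sym hw ht).
by rewrite -!addrA [i w (d t) + _]addrC.
Qed.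

Lemma conformal_killingP (char_k : 2%N \notin [pchar k]) t a : gr Om 1 t ->
  conformal_killing delta i t a <->
  forall w, gr Om 1 w -> Ldelta delta 1 w t + lie i t w = a%:O * w.
Proof.
(* Since the characteristic is not 2, the scalar 1/2 is nonzero and can be cancelled. *)
move=> ht; have half_inj : injective (fun x : Om => 2%:R^-1 *: x).
  apply: scalerI; rewrite invr_eq0; apply: contra char_k => /eqP h2.
  by rewrite inE /= h2 eqxx.
split=> ck w hw; last by rewrite nabla_one_form // ck // addrC.
by have := ck w hw; rewrite nabla_one_form // addrC => /addrI /half_inj.
Qed.

(** The first and third terms of [int_Ldelta] make up (w, L_t e), and the second is -(t, d(w,e)).
    Metric-conformality is thus the conformal Killing equation paired with every one-form [e]. *)
Lemma metric_conformalP t a : gr Om 1 t ->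
  metric_conformal i t a <->
  forall w e, gr Om 1 w -> gr Om 1 e ->
    i e (Ldelta delta 1 w t + lie i t w) = i e (a%:O * w).
Proof.
move=> ht; have key w e : gr Om 1 w -> gr Om 1 e ->
    i e (Ldelta delta 1 w t + lie i t w)
    = i (lie i t w) e + i w (lie i t e) - i t (d (i w e)).
  move=> hw he; rewrite intDr // int_Ldelta // (int_sym he (gr_lie ht hw)).
  rewrite {3}/lie intDr // (int_sym he ht) (int_sym he hw).
  by rewrite [LHS](ACl ((4*(1*3))*2))%AC.
split=> mc w e hw he; have := mc w e hw he; rewrite /inner key // intMr //.
  by rewrite (int_sym he hw) => ->; rewrite addrC addKr.
by move/eqP; rewrite (int_sym he hw) subr_eq => /eqP ->; rewrite addrC.
Qed.

(** * Contraction with the inverse metric *)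

Lemma int_sum_seq (T : eqType) (r : seq T) (F : T -> Om) x :
  {in r, forall j, gr Om 1 (F j)} ->
  i (\sum_(j <- r) F j) x = \sum_(j <- r) i (F j) x.
Proof.
(* Additivity in the first argument holds for one-forms, so the induction also carries the degree of
   the partial sum. *)
move=> hF; suff [] : gr Om 1 (\sum_(j <- r) F j)
    /\ i (\sum_(j <- r) F j) x = \sum_(j <- r) i (F j) x by [].
rewrite !big_seq; elim/big_rec2: _ => [|j y z /hF hj [hz <-]].
  by rewrite int0l; split=> //; apply: gr_zero.
by rewrite intDl //; split=> //; apply: gr_add.
Qed.

(* The metric is symmetric, hence so is its inverse, and the contraction of a
   2-form with a symmetric tensor vanishes. *)
Lemma inverse_metric_contract g x s : inverse_metric i g -> decomposes2 x s ->
  \sum_(p <- g) i p.1 (i p.2 x) = 0.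
Proof.
case=> hg ginv [hs ->]; elim: s hs => [|[w e] s IH] hs.
  rewrite big_nil big_seq big1 // => p /hg [h1 h2].
  by rewrite (int0r h2) int0r.
have [/= hw he] := hs _ (mem_head _ _).
have {}IH := IH (fun p ps => hs p (mem_behead (s := (w, e) :: s) ps)).
(* Expanding gives (g2,w)(g1,e) - (g1,w)(g2,e). Pulled inside the first argument, the two sums
   become w by the two inverse identities, leaving (w,e) - (w,e). *)
transitivity (\sum_(p <- g) i (p.1 * i p.2 w) e - \sum_(p <- g) i (i w p.1 * p.2) e
  + \sum_(p <- g) i p.1 (i p.2 (\sum_(q <- s) q.1 * q.2))).
  rewrite -sumrB -big_split; apply: eq_big_seq => p /hg [h1 h2] /=.
  have h2w := gr_int h2 hw; have h2e := gr_int h2 he; have hw1 := gr_int hw h1.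
  rewrite big_cons /= !intDr // int_mul11 // intBr // (gr0_central _ h2w).
  by rewrite (intMr0 _ h1 h2w) (intMr0r _ h1 h2e) (intMl0 _ h1 h2w)
    (intMl0 _ h2 hw1) (int_sym h1 hw).
rewrite IH addr0 -!int_sum_seq.
- by have [-> ->] := ginv _ hw; rewrite subrr.
- by move=> p /hg [h1 h2]; case/gr0P: (gr_int hw h1) => a ->; apply: gr_inAM.
- move=> p /hg [h1 h2]; rewrite (gr0_central _ (gr_int h2 hw)).
  by case/gr0P: (gr_int h2 hw) => a ->; apply: gr_inAM.
Qed.

(** * Consequences of the conformal Killing equation *)

Lemma metric_conformal_of_killing (char_k : 2%N \notin [pchar k]) t a :
  gr Om 1 t -> conformal_killing delta i t a -> metric_conformal i t a.
Proof.
move=> ht /(conformal_killingP char_k _ ht) ck.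
by apply/(metric_conformalP _ ht) => w e hw _; rewrite ck.
Qed.

Lemma killing_of_metric_conformal (char_k : 2%N \notin [pchar k]) t a :
  metric_nondegenerate i -> gr Om 1 t ->
  metric_conformal i t a -> conformal_killing delta i t a.
Proof.
move=> nondeg ht /(metric_conformalP _ ht) mc.
apply/(conformal_killingP char_k _ ht) => w hw; apply/eqP.
rewrite -subr_eq0; apply/eqP; apply: nondeg => [|e he].
  apply: gr_add; last exact/gr_opp/gr_inAM.
  by apply: gr_add; [apply: gr_Ldelta | apply: gr_lie].
by rewrite /inner intBr // mc // subrr.
Qed.

Lemma one_form_sq (char_k : 2%N \notin [pchar k]) t : gr Om 1 t -> t * t = 0.
Proof.
move=> ht; have /eqP := mul1form_anti ht ht.
rewrite -addr_eq0 -mulr2n -scaler_nat scaler_eq0 => /orP [h2|/eqP //].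
by move: char_k; rewrite inE /= h2.
Qed.

Lemma Ldelta_one_form w t : gr Om 1 t ->
  Ldelta delta 1 w t = delta (w * t) - delta w * t + delta t * w.
Proof.
by move=> ht; rewrite /Ldelta expr1 scaleN1r opprK (gr0_central _ (gr_delta ht)).
Qed.

(** At w = t the defect [Ldelta] vanishes: t*t = 0, and the two remaining terms are opposite. *)
Lemma lie_killing (char_k : 2%N \notin [pchar k]) t a : gr Om 1 t ->
  conformal_killing delta i t a -> lie i t t = a%:O * t.
Proof.
move=> ht /(conformal_killingP char_k _ ht) <- //.
by rewrite Ldelta_one_form // one_form_sq // linear0 sub0r addNr add0r.
Qed.

(** Contraction with g kills the 2-form part i_w(dt) of the covariant derivative; only the trace of
    a/2 times the identity remains. *)
Lemma delta_nabla_killing t a g : gr Om 1 t -> conformal_killing delta i t a ->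
  inverse_metric i g ->
  2%:R^-1 *: (\sum_(p <- g) i p.1 p.2) * a%:O = delta_nabla delta i g t.
Proof.
move=> ht ck ginv; have hg := ginv.1.
have [s hs] := dd_one_form_decomposes ht.
transitivity (2%:R^-1 *: (\sum_(p <- g) i p.1 (i p.2 (d t)))
  + 2%:R^-1 *: (\sum_(p <- g) a%:O * i p.1 p.2)).
  rewrite (inverse_metric_contract ginv hs) scaler0 add0r.
  by rewrite inA_central -mulr_sumr -scalerAr.
rewrite -scalerDr -big_split scaler_sumr; apply: eq_big_seq => p /hg [h1 h2] /=.
by rewrite ck // intDr // !intZr // intMr // scalerDr.
Qed.

(** This is [delta] applied to the Killing equation. The products of [delta w] and [delta t] cancel,
    and i_{d(delta w)} t is L_t(delta w) by symmetry. *)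
Lemma delta_lie_killing (char_k : 2%N \notin [pchar k]) t a w :
  gr Om 1 t -> gr Om 1 w -> conformal_killing delta i t a ->
  delta (delta (w * t)) + (delta (lie i t w) - lie i t (delta w))
  = a%:O * delta w + i (d a%:O) w - i (d (delta t)) w.
Proof.
move=> ht hw /(conformal_killingP char_k _ ht) ck.
have hdt := gr_delta ht; have hdw := gr_delta hw.
(* The first two terms on the right are [delta] of a*w, into which the Killing equation is
   substituted. *)
rewrite -deltaM -ck // Ldelta_one_form //; move: (lie i t w) => v.
rewrite lie0 // !linearD linearN (deltaM0 _ hdw) (deltaM0 _ hdt) (int_sym ht (dd_gr hdw)).
rewrite (gr0_central _ hdw) opprD.
set p := delta w * delta t; set q := delta (delta (w * t)); set r := i _ t.
set u := i _ w; rewrite !addrA.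
by rewrite [RHS](ACl ((1*6*3)*(2*4)*(5*7)))%AC /= addNr subrr !addr0.
Qed.

(** * Delta-conformal one-forms *)

Lemma delta_conformal_exact t a (beta : k) b e : gr Om 1 t -> gr Om 1 e ->
  delta_conformal delta i t a beta ->
  i (lie i t (d b%:O)) e + i (d b%:O) (lie i t e)
  = i t (d (i (d b%:O) e)) + a%:O * i (d b%:O) e.
Proof.
move=> ht he dc; have hb := gr_d_inA b.
have hbt : gr Om 0 (i t (d b%:O)) by apply: gr_int.
have hbe : gr Om 0 (i (d b%:O) e) by apply: gr_int.
have := dc _ (gr_inAM b he).
have -> : lie i t (d b%:O) = d (i t (d b%:O)).
  by rewrite /lie dd_dd int0r // addr0.
have -> : delta (lie i t (b%:O * e))
    = i t (d b%:O) * delta e + i (d (i t (d b%:O))) e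
      + (b%:O * delta (lie i t e) + i (d b%:O) (lie i t e)).
  by rewrite lie_inAM // linearD (deltaM0 _ hbt) deltaM.
have -> : lie i t (delta (b%:O * e))
    = i t (d b%:O) * delta e + b%:O * lie i t (delta e) + i t (d (i (d b%:O) e)).
  rewrite -lie_inAM // -(lie0 ht hbe) deltaM /lie intDr // [d (_ + _)]linearD.
  by rewrite [d (_ + _)]linearD intDr // addrACA.
(* The condition at [e], used backwards, absorbs the term with [1 - beta], which is A-linear in the
   form; so the constant drops out of the comparison. *)
have -> : a%:O * delta (b%:O * e) + (1 - beta) *: i (d a%:O) (b%:O * e)
    = b%:O * delta (lie i t e) - b%:O * lie i t (delta e) + a%:O * i (d b%:O) e.
  rewrite -mulrBr dc // (intMr _ _ (gr_d_inA a)) deltaM !mulrDr scalerAr.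
  by rewrite !mulrA (inA_central b) addrAC.
set p := b%:O * delta _; set q := b%:O * lie _ _ _; set r := _ * delta e.
rewrite !opprD !addrA.
rewrite [X in X = _ -> _](ACl (((3*6)*((2*4)*7))*(1*5)))%AC /= subrr addr0.
by move/addrI/eqP; rewrite subr_eq => /eqP ->; rewrite addrC.
Qed.

(** Extends the exact case: both sides are additive in [w], and multiplying [w] by b contributes the
    same extra term (t,db)(w,e) to each. *)
Lemma metric_conformal_of_delta t a (beta : k) : gr Om 1 t ->
  delta_conformal delta i t a beta -> metric_conformal i t a.
Proof.
move=> ht dc w e hw he; rewrite /inner.
move: w hw; apply: one_form_ind => [|b b' w hw IH].
  have -> : lie i t 0 = 0 by rewrite /lie int0r // linear0 int0r // addr0.
  by rewrite !int0l linear0 int0r // mulr0.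
have hb := gr_d_inA b; have hb' := gr_d_inA b'.
have hle := gr_lie ht hb'; have hb'e := gr_int hb' he.
have -> : lie i t (b%:O * d b'%:O + w)
    = i t (d b%:O) * d b'%:O + (b%:O * lie i t (d b'%:O) + lie i t w).
  rewrite addrA -lie_inAM // /lie intDr // [d (_ + _)]linearD [d (_ + w)]linearD.
  by rewrite intDr // addrACA.
have hM f x : gr Om 0 f -> gr Om 1 x -> gr Om 1 (f * x).
  by move=> hf hx; apply: (gr_mul hf hx).
have hbt := gr_int ht hb; have hlw := gr_lie ht hw.
rewrite (intDl _ (hM _ _ hbt hb')); last by apply: gr_add => //; apply: gr_inAM.
rewrite (intMl0 _ hb' hbt) !intDZl // [d (_ + _)]linearD [i t (_ + _)]intDr // int_d_inAM //.
rewrite [a%:O * _]mulrDr (mulrA a%:O) (inA_central b a%:O) -(mulrA b%:O).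
have := delta_conformal_exact b' ht he dc; move/(congr1 ( *%R b%:O)).
rewrite !mulrDr => E.
rewrite [LHS](AC ((1*2)*2) (1*((2*4)*(3*5))))%AC /= E IH.
by rewrite [RHS](AC ((2*1)*2) (1*((2*4)*(3*5))))%AC.
Qed.

(** Two formulas for the commutator of [delta] with L_t, evaluated at t itself, are compared. As t*t
    = 0, they give beta (da,t) = (d(delta t),t). *)
Lemma int_d_killing_delta (char_k : 2%N \notin [pchar k]) t a (beta : k) :
  gr Om 1 t -> beta != 0 -> conformal_killing delta i t a ->
  delta_conformal delta i t a beta ->
  i t (d (a%:O - beta^-1 *: delta t)) = 0.
Proof.
move=> ht b0 ck dc; have ha := gr_d_inA a; have hd := dd_gr (gr_delta ht).
have := delta_lie_killing char_k ht ht ck.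
rewrite dc // one_form_sq // !linear0 add0r -addrA => /addrI.
rewrite scalerBl scale1r => /addrI /oppr_inj E.
rewrite linearB linearZ intBr // intZr // (int_sym ht hd) -E scalerA mulVf //.
by rewrite scale1r (int_sym ht ha) subrr.
Qed.

End InteriorProduct.
End ClassicalTypeTheory.

(** * The four implications for a one-form [tau] *)

Theorem lemma4p3 (k : fieldType) (char_k : 2%N \notin [pchar k])
    (A : algType k) (Om : dga A) (Om_classical : classical_type Om)
    (delta : {linear Om -> Om}) (i : Om -> Om -> Om)
    (delta_classical : classical_codiff delta i)
    (tau : Om) (tau1 : gr Om 1 tau) :
  [/\ (forall alpha : A,
          conformal_killing delta i tau alpha -> metric_conformal i tau alpha) /\
       (metric_nondegenerate i -> forall alpha : A,
          conformal_killing delta i tau alpha <-> metric_conformal i tau alpha),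
      forall alpha : A, conformal_killing delta i tau alpha ->
        lie i tau tau = inA Om alpha * tau /\
        forall g : seq (Om * Om), inverse_metric i g ->
          let beta := 2%:R^-1 *: (\sum_(p <- g) inner i p.1 p.2) in
          beta * inA Om alpha = delta_nabla delta i g tau /\
          (forall b : A, inA Om b * beta = 1 ->
             inA Om alpha = inA Om b * delta_nabla delta i g tau),
      forall (alpha : A) (beta : k), beta != 0 ->
        inA Om alpha = beta^-1 *: delta tau ->
        conformal_killing delta i tau alpha ->
        (forall x : Om, delta (delta x) = 0) ->
        delta_conformal delta i tau alpha beta
    & forall (alpha : A) (beta : k),
        delta_conformal delta i tau alpha beta ->
        metric_conformal i tau alpha /\
        (metric_nondegenerate i -> beta != 0 ->
           inner i tau (dd Om (inA Om alpha - beta^-1 *: delta tau)) = 0)].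
Proof.
have [mc_of_ck ck_of_mc] : (forall alpha : A,
    conformal_killing delta i tau alpha -> metric_conformal i tau alpha) /\
  (metric_nondegenerate i -> forall alpha : A,
    metric_conformal i tau alpha -> conformal_killing delta i tau alpha).
  split=> [|nondeg] alpha; first exact: metric_conformal_of_killing.
  exact: killing_of_metric_conformal.
split.
- split=> // nondeg alpha; split; first exact: mc_of_ck.
  exact: ck_of_mc.
- move=> alpha ck; split; first exact: lie_killing ck.
  move=> g ginv beta; have E : beta * inA Om alpha = delta_nabla delta i g tau.
    exact: delta_nabla_killing.
  by split=> // b bbeta; rewrite -E mulrA bbeta mul1r.
- move=> alpha beta beta0 alphaE ck delta2 w w1.
  (* As [beta] is constant, d(delta tau) = beta d(alpha); this turns the last two terms of
     [delta_lie_killing] into the required multiple [1 - beta]. *)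
  have dtau : delta tau = beta *: inA Om alpha.
    by rewrite alphaE scalerA mulfV // scale1r.
  have := delta_lie_killing Om_classical delta_classical char_k tau1 w1 ck.
  rewrite delta2 add0r => ->; have da := gr_d_inA Om alpha.
  have db : gr Om 1 (dd Om (beta *: inA Om alpha)) by rewrite linearZ; apply: gr_scale.
  rewrite dtau -addrA; congr (_ + _).
  rewrite (int_sym Om_classical delta_classical db w1) linearZ.
  rewrite (intZr delta_classical) // scalerBl scale1r.
  by rewrite (int_sym Om_classical delta_classical w1 da).
- move=> alpha beta dc.
  have mc := metric_conformal_of_delta Om_classical delta_classical tau1 dc.
  split=> // nondeg beta0.
  (* Nondegeneracy upgrades metric-conformal to conformal Killing, which supplies the second formula
     for the commutator. *)
  exact: (int_d_killing_delta Om_classical delta_classical char_k tau1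
    beta0 (ck_of_mc nondeg _ mc) dc).
Qed.
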